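(* Let $S$ be a pointed affine semigroup, and let $\partial$ be a nonzero quasi-homogeneous locally nilpotent derivation on $\mathbb{C}[S_\infty]$ of degree $e\in\mathcal{R}_\rho(S)$. Then $\partial$ is topologically integrable if and only if $-e\notin S$.
   Context: An affine semigroup is a commutative semigroup $S$ (written additively) with identity $0$ which is finitely generated and embeddable in a lattice $\mathbb{Z}^n$; $M=\mathbb{Z}S=\{a-b\mid a,b\in S\}$ is the lattice it generates and $N=\operatorname{Hom}(M,\mathbb{Z})$, with pairing $\langle\ ,\ \rangle\colon M\times N\to\mathbb{Z}$. $S$ is pointed if $a+b=0$ with $a,b\in S$ implies $a=b=0$. $S_\infty=S\cup\{\infty\}$ is the semigroup extending $S$ by $a+\infty=\infty+a=\infty$ for all $a\in S_\infty$. For a semigroup $T$ with identity, $\mathbb{C}[T]=\bigoplus_{a\in T}\mathbb{C}\chi^a$ with $\chi^a\chi^b=\chi^{a+b}$, $1=\chi^0$. A derivation of a $\mathbb{C}$-algebra $B$ is a $\mathbb{C}$-linear map $\partial\colon B\to B$ satisfying the Leibniz rule; it is locally nilpotent if for every $f\in B$ there is $n$ with $\partial^{(n)}(f)=0$, where $\partial^{(n)}$ is the $n$-fold composition. Correspondence: each derivation $\partial$ of $\mathbb{C}[S_\infty]$ corresponds to a unique derivation $\partial'$ of $\mathbb{C}[S]$ such that $\partial(\chi^\infty)=0$ and $\partial(\chi^a)=(1-\chi^\infty)\partial'(\chi^a)$ for all $a\in S$. A nonzero derivation $\partial'$ of $\mathbb{C}[S]$ is homogeneous of degree $e\in M$ if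 for each $a\in S$ the element $\partial'(\chi^a)$ lies in $\mathbb{C}\chi^{a+e}$ (read as $\{0\}$ if $a+e\notin S$). The derivation $\partial$ is quasi-homogeneous of degree $e$ if $\partial'$ is homogeneous of degree $e$. Demazure roots: let $S^{sat}=\{a\in M\mid ka\in S\text{ for some integer }k>0\}$, let $\sigma\subset N_{\mathbb{R}}=N\otimes\mathbb{R}$ be the dual cone of the cone in $M\otimes\mathbb{R}$ generated by $S$, and let $\sigma(1)$ be its set of rays, each identified with its primitive generator in $N$. An element $e\in M$ is a Demazure root of $S^{sat}$ with distinguished ray $\rho\in\sigma(1)$ if $\langle e,\rho\rangle=-1$ and $\langle e,\rho'\rangle\ge0$ for all $\rho'\in\sigma(1)$, $\rho'\ne\rho$; it defines the derivation $\partial_e(\chi^a)=\langle a,\rho\rangle\chi^{a+e}$ of $\mathbb{C}[S^{sat}]$. A Demazure root of $S$ is a Demazure root $e$ of $S^{sat}$ such that $\partial_e(\mathbb{C}[S])\subset\mathbb{C}[S]$; $\mathcal{R}_\rho(S)$ is the set of Demazure roots of $S$ with distinguished ray $\rho$. Topology on $\mathbb{C}[S_\infty]$: let $\mathscr{H}=\{a_1,\dots,a_s\}$ be the Hilbert basis of $S$, i.e. the finite set of irreducible elements ($a\ne0$ is irreducible if $a=b+c$ with $b,c\in S$ implies $b=a$ or $c=a$). Put $\mathfrak{s}(a)=\max\{\sum_{k=1}^s\alpha_k\mid a=\sum_{k=1}^s\alpha_ka_k,\ \alpha_k\in\mathbb{N}\}$ for $a\in S$ and $H_i=\{a\in S\mid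 \mathfrak{s}(a)\le i\}$ for $i\in\mathbb{N}$. Let $\mathfrak{a}_i$ be the ideal of $\mathbb{C}[S_\infty]$ generated by $\{\chi^a-\chi^\infty\mid a\in S,\ a\notin H_i\}$. The ideals $\mathfrak{a}_0\supset\mathfrak{a}_1\supset\cdots$ form a fundamental system of neighbourhoods of $0$. A continuous derivation $\partial$ of $\mathbb{C}[S_\infty]$ is topologically integrable if for every $f\in\mathbb{C}[S_\infty]$ and every $i\in\mathbb{N}$ there exist $n_0,j\in\mathbb{N}$ such that $\partial^{(n)}(f+\mathfrak{a}_j)\subset\mathfrak{a}_i$ for every integer $n\ge n_0$. *)

(* Defs.v *)
From HB Require Import structures.
From mathcomp Require Import all_boot all_order all_algebra.
From mathcomp Require Import finmap.
From mathcomp Require Import boolp classical_sets cardinality reals.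
From mathcomp Require Import complex.
From mathcomp.multinomials Require Import monalg.

Set Implicit Arguments.
Unset Strict Implicit.
Unset Printing Implicit Defensive.

Import Order.TTheory GRing.Theory Num.Theory.

Local Open Scope ring_scope.
Local Open Scope classical_set_scope.

(* [{additive S -> 'rV[int]_n}] between N-modules means that 0 and + are
   preserved. *)
HB.mixin Record Nmodule_isAffine S of GRing.Nmodule S := {
  affine_fg : exists gens : seq S, forall a : S, exists c : S -> nat,
    a = \sum_(x <- gens) x *+ c x;
  affine_embedding : exists (n : nat) (f : {additive S -> 'rV[int]_n}),
    injective f
}.

HB.mixin Record Nmodule_isPointed S of GRing.Nmodule S := {
  pointedP : forall a b : S, a + b = 0 -> a = 0 /\ b = 0
}.

#[short(type="pointedAffineSemigroup")]
HB.structure Definition PointedAffineSemigroup :=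
  { S of GRing.Nmodule S & Nmodule_isAffine S & Nmodule_isPointed S }.

(* The algebras [{malg C[K]}] are indexed by a multiplicatively written
   monoid [K : conomType] without nontrivial units; [monomials S] and
   [monomials_infty S] are S and S_infty in that notation ([None] is the
   absorbing element). *)
Definition monomials (S : pointedAffineSemigroup) : Type := S.

Section Monomials.
Variable S : pointedAffineSemigroup.

HB.instance Definition _ := Choice.copy (monomials S) S.

Definition monomials_one : monomials S := (0 : S).
Definition monomials_mul (a b : monomials S) : monomials S :=
  ((a : S) + (b : S) : S).

Lemma monomials_mulA : associative monomials_mul.
Proof. exact: addrA. Qed.
Lemma monomials_mul1m : left_id monomials_one monomials_mul.
Proof. exact: add0r. Qed.
Lemma monomials_mulm1 : right_id monomials_one monomials_mul.
Proof. exact: addr0. Qed.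
Lemma monomials_unitm (x y : monomials S) :
  monomials_mul x y = monomials_one -> x = monomials_one /\ y = monomials_one.
Proof. exact: pointedP. Qed.
Lemma monomials_mulC : commutative monomials_mul.
Proof. exact: addrC. Qed.

HB.instance Definition _ := Choice_isMonomialDef.Build (monomials S)
  monomials_mulA monomials_mul1m monomials_mulm1 monomials_unitm.
HB.instance Definition _ :=
  MonomialDef_isConomialDef.Build (monomials S) monomials_mulC.

Definition monomials_infty : Type := option S.

HB.instance Definition _ := Choice.copy monomials_infty (option S).

Definition infty_one : monomials_infty := Some 0.
Definition infty_mul (a b : monomials_infty) : monomials_infty :=
  if a is Some x then if b is Some y then Some (x + y) else None else None.

Lemma infty_mulA : associative infty_mul.
Proof. by move=> [x|] [y|] [z|] //=; rewrite addrA. Qed.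
Lemma infty_mul1m : left_id infty_one infty_mul.
Proof. by move=> [x|] //=; rewrite add0r. Qed.
Lemma infty_mulm1 : right_id infty_one infty_mul.
Proof. by move=> [x|] //=; rewrite addr0. Qed.
Lemma infty_unitm (x y : monomials_infty) :
  infty_mul x y = infty_one -> x = infty_one /\ y = infty_one.
Proof. by case: x y => [x|] [y|] //= [] /pointedP[-> ->]. Qed.
Lemma infty_mulC : commutative infty_mul.
Proof. by move=> [x|] [y|] //=; rewrite addrC. Qed.

HB.instance Definition _ := Choice_isMonomialDef.Build monomials_infty
  infty_mulA infty_mul1m infty_mulm1 infty_unitm.
HB.instance Definition _ :=
  MonomialDef_isConomialDef.Build monomials_infty infty_mulC.

End Monomials.

(* C[S], C[S_infty], and, as a vector space only, C[M]. *)
Notation CS R S := {malg (complex R)[monomials S]}.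
Notation CSinf R S := {malg (complex R)[monomials_infty S]}.
Notation CM R M := {malg (complex R)[M]}.

Definition chi (R : realType) (S : pointedAffineSemigroup) (a : S) : CS R S :=
  << 1 *g (a : monomials S) >>.
Definition chi_fin (R : realType) (S : pointedAffineSemigroup) (a : S) :
  CSinf R S := << 1 *g (Some a : monomials_infty S) >>.
Definition chi_infty (R : realType) (S : pointedAffineSemigroup) : CSinf R S :=
  << 1 *g (None : monomials_infty S) >>.

Definition CS_inclusion (R : realType) (S : pointedAffineSemigroup)
    (g : CS R S) : CSinf R S :=
  \sum_(a <- msupp g) g@_a *: chi_fin R a.

Section Derivations.
Variables (K : nzRingType) (B : lalgType K).

Definition derivation (D : {linear B -> B}) : Prop :=
  forall f g : B, D (f * g) = D f * g + f * D g.

Definition locally_nilpotent (D : {linear B -> B}) : Prop :=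
  forall f : B, exists n : nat, iter n D f = 0.

Definition ideal_generated (G : set B) : set B :=
  [set f | exists s : seq (B * B),
     (forall p, p \in s -> G p.2) /\ f = \sum_(p <- s) p.1 * p.2].

End Derivations.

(* [iota] realizes M as the lattice ZS = {a - b | a, b in S}. *)
Definition generated_lattice (S : pointedAffineSemigroup) (M : zmodType)
    (iota : {additive S -> M}) : Prop :=
  injective iota /\ forall m : M, exists a b : S, m = iota a - iota b.

Section QuasiHomogeneous.
Variables (R : realType) (S : pointedAffineSemigroup) (M : zmodType).
Variable iota : {additive S -> M}.

Definition homogeneous (e : M) (D' : {linear CS R S -> CS R S}) : Prop :=
  (exists f, D' f != 0) /\
  forall a : S,
    (forall b : S, iota b = iota a + e ->
       exists c : complex R, D' (chi R a) = c *: chi R b) /\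
    ((~ exists b : S, iota b = iota a + e) -> D' (chi R a) = 0).

Definition corresponds (D : {linear CSinf R S -> CSinf R S})
    (D' : {linear CS R S -> CS R S}) : Prop :=
  D (chi_infty R S) = 0 /\
  forall a : S, D (chi_fin R a) =
    (1 - chi_infty R S) * CS_inclusion (D' (chi R a)).

Definition quasi_homogeneous (e : M) (D : {linear CSinf R S -> CSinf R S})
    : Prop :=
  exists D' : {linear CS R S -> CS R S},
    [/\ derivation D', corresponds D D' & homogeneous e D'].

End QuasiHomogeneous.

(* N = Hom(M, Z) is [{additive M -> int}], and N_R = N (x) R is identified
   with Hom(M, R) = [{additive M -> R}]. *)
Section DemazureRoots.
Variables (R : realType) (S : pointedAffineSemigroup) (M : zmodType).
Variable iota : {additive S -> M}.

(* Nonnegativity on the cone generated by S amounts to nonnegativity on S. *)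
Definition dual_cone : set {additive M -> R} :=
  [set y : {additive M -> R} | forall a : S, 0 <= y (iota a)].

Definition halfline (rho : {additive M -> int}) : set {additive M -> R} :=
  [set y : {additive M -> R} |
     exists2 t : R, 0 <= t & forall m, y m = t * (rho m)%:~R].

(* As a half-line is a convex cone, this says that it is a face of the cone. *)
Definition halfline_face (rho : {additive M -> int}) : Prop :=
  halfline rho `<=` dual_cone /\
  forall y z : {additive M -> R}, dual_cone y -> dual_cone z ->
    halfline rho (y \+ z) -> halfline rho y /\ halfline rho z.

Definition primitive (rho : {additive M -> int}) : Prop :=
  (exists m, rho m != 0) /\
  forall (k : nat) (tau : {additive M -> int}),
    (forall m, rho m = tau m *+ k) -> k = 1%N.

(* sigma(1): the rays (one-dimensional faces) of the dual cone, each given by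
   its primitive generator. *)
Definition ray (rho : {additive M -> int}) : Prop :=
  primitive rho /\ halfline_face rho.

(* S^sat and S generate the same cone, so this only refers to [iota]. *)
Definition demazure_root_sat (rho : {additive M -> int}) (e : M) : Prop :=
  [/\ ray rho, rho e = -1 &
      forall rho' : {additive M -> int}, ray rho' -> ~ (rho' =1 rho) ->
        0 <= rho' e].

(* chi^a |-> <a, rho> chi^(a + e), extended linearly to C[M], which contains
   C[S^sat] and C[S]; only its values on C[S] are used. *)
Definition demazure_derivation (rho : {additive M -> int}) (e : M)
    (f : CM R M) : CM R M :=
  \sum_(a <- msupp f) << f@_a * (rho a)%:~R *g a + e >>.

(* C[S] as a subspace of C[M]. *)
Definition CS_in_CM : set (CM R M) :=
  [set f | forall m, m \in msupp f -> exists a : S, m = iota a].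

Definition demazure_root (rho : {additive M -> int}) (e : M) : Prop :=
  demazure_root_sat rho e /\
  forall f, CS_in_CM f -> CS_in_CM (demazure_derivation rho e f).

End DemazureRoots.

Section Topology.
Variables (R : realType) (S : pointedAffineSemigroup).

Definition irreducible_element (a : S) : Prop :=
  a <> 0 /\ forall b c : S, a = b + c -> b = a \/ c = a.

(* [fset_set] is the finite set with the given elements when the argument is
   finite (as it is here), and is empty otherwise. *)
Definition hilbert_basis : {fset S} := fset_set [set a | irreducible_element a].

Definition lengths (a : S) : set nat :=
  [set k | exists2 alpha : S -> nat,
     a = \sum_(x <- hilbert_basis) x *+ alpha x &
     k = (\sum_(x <- hilbert_basis) alpha x)%N].

(* [lengths a] is finite and nonempty, S being pointed. *)
Definition max_length (a : S) : nat := (\max_(k <- fset_set (lengths a)) k)%N.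

Definition H_ (i : nat) : set S := [set a | (max_length a <= i)%N].

Definition nbhs_ideal (i : nat) : set (CSinf R S) :=
  ideal_generated [set f | exists2 a : S, ~ H_ i a &
                                          f = chi_fin R a - chi_infty R S].

Definition continuous_map (D : CSinf R S -> CSinf R S) : Prop :=
  forall (f : CSinf R S) (i : nat), exists j : nat,
    forall g, nbhs_ideal j g -> nbhs_ideal i (D (f + g) - D f).

Definition topologically_integrable (D : {linear CSinf R S -> CSinf R S})
    : Prop :=
  continuous_map D /\
  forall (f : CSinf R S) (i : nat), exists n0 j : nat,
    forall n : nat, (n0 <= n)%N ->
      forall g, nbhs_ideal j g -> nbhs_ideal i (iter n D (f + g)).

End Topology.

(* Main.v *)
(** The derivation is [D (chi^a) = lambda rho(a) (chi^(a+e) - chi^oo)] with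
    [lambda != 0], so [D^n (chi^a - chi^oo)] is a nonzero multiple of
    [chi^(a+n e) - chi^oo] for [n <= rho(a)], and 0 afterwards; moreover the
    ideal [a_i] is the span of the [chi^a - chi^oo] with [a] outside [H_i].
    If [-e] is in S, then [D^n] maps the elements [chi^(-n e) - chi^oo], which
    tend to 0, to nonzero multiples of [1 - chi^oo].  Otherwise, for [h] in S,
    [h - n e] is outside S for [n] large, and uniformly so on the finite set
    [H_i]; hence [D^n] maps every [chi^a - chi^oo] into [a_i] for [n] large. *)

Require Import Defs.
From HB Require Import structures.
From mathcomp Require Import all_boot all_order all_algebra.
From mathcomp Require Import finmap.
From mathcomp Require Import boolp classical_sets cardinality reals.
From mathcomp Require Import complex.
From mathcomp.multinomials Require Import monalg.

Set Implicit Arguments.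
Unset Strict Implicit.
Unset Printing Implicit Defensive.

Import Order.TTheory GRing.Theory Num.Theory.

Local Open Scope ring_scope.

(** * Dickson's lemma for sequences of exponent vectors *)

Lemma tail_minimum (u : nat -> nat) (N : nat) :
  exists2 m, (N <= m)%N & forall k, (m <= k)%N -> (u m <= u k)%N.
Proof.
suff H v : forall M, (N <= M)%N -> (u M <= v)%N ->
    exists2 m, (N <= m)%N & forall k, (m <= k)%N -> (u m <= u k)%N.
  exact: (H (u N) N).
(* Either a later value stays below the bound [v.+1], which can then be lowered, or [u M] is already
   minimal on its tail. *)
elim: v => [|v IH] M NM uM.
  by exists M => // k _; move: uM; rewrite leqn0 => /eqP->.
have [[k [Mk uk]]|no] := pselect (exists k, (M <= k)%N /\ (u k <= v)%N).
  exact: IH k (leq_trans NM Mk) uk.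
exists M => // k Mk; apply: leq_trans uM _; rewrite ltnNge.
by apply/negP => uk; apply: no; exists k.
Qed.

(** Each chosen index is a tail minimum found strictly beyond the previous one. *)
Lemma nondecreasing_subsequence (u : nat -> nat) :
  exists2 phi : nat -> nat, {homo phi : m n / (m < n)%N} &
    {homo u \o phi : m n / (m <= n)%N}.
Proof.
have H N : exists m, (N <= m)%N /\ forall k, (m <= k)%N -> (u m <= u k)%N.
  by have [m] := tail_minimum u N; exists m.
have {H}[g gP] := choice H.
pose phi n := iter n (fun m => g m.+1) (g 0).
have phi_lt n : (phi n < phi n.+1)%N by have [] := gP (phi n).+1.
have phi_min n k : (phi n <= k)%N -> (u (phi n) <= u k)%N.
  by case: n => [|n]; apply: (gP _).2.
have phi_homo : {homo phi : m n / (m < n)%N} by apply: homo_ltn ltn_trans phi_lt.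
exists phi => // m n; rewrite leq_eqVlt => /predU1P[->//|/phi_homo /ltnW].
exact: phi_min.
Qed.

(** Coordinates are treated one at a time: refining a subsequence keeps those already made
    monotone. *)
Lemma dickson_subsequence (T : eqType) (s : seq T) (alpha : nat -> T -> nat) :
  exists2 phi : nat -> nat, {homo phi : m n / (m < n)%N} &
    forall x, x \in s -> {homo (fun n => alpha (phi n) x) : m n / (m <= n)%N}.
Proof.
elim: s => [|y s [phi phi_lt phi_le]]; first by exists id.
have [psi psi_lt psi_le] := nondecreasing_subsequence (fun n => alpha (phi n) y).
exists (phi \o psi) => [m n /psi_lt /phi_lt //|x].
rewrite inE => /predU1P[->//|xs] m n mn /=; apply: phi_le => //.
by move: mn; rewrite leq_eqVlt => /predU1P[->//|/psi_lt /ltnW].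
Qed.

Lemma dickson (T : eqType) (s : seq T) (alpha : nat -> T -> nat) :
  exists m n, (m < n)%N /\ {in s, forall x, (alpha m x <= alpha n x)%N}.
Proof.
have [phi phi_lt phi_le] := dickson_subsequence s alpha.
by exists (phi 0), (phi 1); split=> [|x xs]; [exact: phi_lt|exact: phi_le].
Qed.

(** * Hilbert basis, factorization lengths and the sets [H_ i] *)

Section PointedAffineSemigroup.
Variable S : pointedAffineSemigroup.
Implicit Types (a b c : S) (s : seq S).

Lemma semigroup_addrI a : injective (+%R a).
Proof.
have [n [f f_inj]] := affine_embedding (s := S).
by move=> b c /(congr1 f); rewrite !raddfD => /addrI /f_inj.
Qed.

Lemma comb_sub s (alpha beta : S -> nat) :
  {in s, forall x, (alpha x <= beta x)%N} ->
  \sum_(x <- s) x *+ beta x =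
  \sum_(x <- s) x *+ alpha x + \sum_(x <- s) x *+ (beta x - alpha x).
Proof.
move=> le_ab; rewrite -big_split /= [LHS]big_seq [RHS]big_seq.
by apply: eq_bigr => x /le_ab ab; rewrite -mulrnDr subnKC.
Qed.

Lemma semigroup_dickson (u : nat -> S) :
  exists m n, (m < n)%N /\ exists c, u n = u m + c.
Proof.
have [gens gensP] := affine_fg (s := S).
have [alpha alphaP] := choice (fun n => gensP (u n)).
have [m [n [mn le_mn]]] := dickson gens alpha.
exists m, n; split=> //; exists (\sum_(x <- gens) x *+ (alpha n x - alpha m x)).
by rewrite {1}(alphaP n) (alphaP m) (comb_sub le_mn).
Qed.

(** An irreducible element equals one of the summands in any expression for it, so it occurs in
    every finite generating family. *)
Lemma finite_irreducible : finite_set [set a : S | irreducible_element a].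
Proof.
have [gens gensP] := affine_fg (s := S).
apply: (sub_finite_set _ (finite_seq gens)) => a [a_neq0 a_irr] /=.
have irr_mem : forall s (alpha : S -> nat),
    a = \sum_(x <- s) x *+ alpha x -> a \in s.
  move=> s alpha; elim: s => [|x s IH]; first by rewrite big_nil => /a_neq0.
  rewrite big_cons inE => aE; have [ax|/esym /IH ->] := a_irr _ _ aE; last first.
    by rewrite orbT.
  suff -> : a == x by [].
  elim: (alpha x) ax => [|k IHk]; first by rewrite mulr0n => /esym /a_neq0.
  by rewrite mulrS => /esym /a_irr [->|/IHk].
by have [alpha /irr_mem] := gensP a.
Qed.

Lemma hilbert_basisP a : reflect (irreducible_element a) (a \in hilbert_basis S).
Proof.
rewrite in_fset_set; last exact: finite_irreducible.
by apply: (iffP idP); rewrite inE.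
Qed.

Definition comb (alpha : S -> nat) : S := \sum_(x <- hilbert_basis S) x *+ alpha x.

Definition weight (alpha : S -> nat) : nat :=
  (\sum_(x <- hilbert_basis S) alpha x)%N.

Lemma combD alpha beta :
  comb (fun x => alpha x + beta x)%N = comb alpha + comb beta.
Proof. by rewrite -big_split /=; apply: eq_bigr => x _; rewrite mulrnDr. Qed.

Lemma comb_irreducible a : irreducible_element a -> comb (fun x => x == a) = a.
Proof.
move=> /hilbert_basisP aH; rewrite /comb (big_fsetD1 a) //= eqxx mulr1n.
rewrite big_seq big1 ?addr0 // => x; rewrite !inE => /andP[/negPf-> _].
by rewrite mulr0n.
Qed.

(* An element which is not a combination splits off a nonzero summand leaving
   another such element; by Dickson's lemma and cancellation this cannot go on
   forever in a pointed semigroup. *)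
Lemma hilbert_basis_generates a : exists alpha, a = comb alpha.
Proof.
apply: contrapT => a_bad; pose bad b := ~ exists alpha, b = comb alpha.
(* The implication is kept inside the existential so that [choice] gives a total function; [(0, 0)]
   is a dummy value. *)
have step b : exists p : S * S, bad b -> [/\ b = p.1 + p.2, p.2 <> 0 & bad p.1].
  have [b_bad|b_good] := pselect (bad b); last by exists (0, 0) => /b_good.
  suff [p pP] : exists p : S * S, [/\ b = p.1 + p.2, p.2 <> 0 & bad p.1].
    by exists p.
  have b_neq0 : b <> 0.
    move=> b0; apply: b_bad; exists (fun=> 0%N).
    by rewrite b0 /comb big1 // => x _; rewrite mulr0n.
  have b_red : ~ irreducible_element b.
    by move=> b_irr; apply: b_bad; exists (fun x => x == b); rewrite comb_irreducible.
  have [c [d [bE cb db]]] : exists c d, [/\ b = c + d, c <> b & d <> b].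
    apply: contrapT => no; apply: b_red; split=> // c d bE.
    have [->|cb] := eqVneq c b; first by left.
    have [->|db] := eqVneq d b; first by right.
    by exfalso; apply: no; exists c, d; split=> //; apply/eqP.
  have [c_bad|/contrapT[alpha cE]] := pselect (bad c).
    exists (c, d); split=> //= d0; apply: cb.
    by rewrite bE d0 addr0.
  exists (d, c); split=> /=; first by rewrite addrC.
    by move=> c0; apply: db; rewrite bE c0 add0r.
  move=> [beta dE]; apply: b_bad; exists (fun x => alpha x + beta x)%N.
  by rewrite combD -cE -dE.
have {step}[f fP] := choice step.
pose u n := iter n (fun b => (f b).1) a.
have u_bad n : bad (u n) by elim: n => //= n /fP[].
have u_desc m k : exists2 c, u m = u (m + k.+1)%N + c & c <> 0.
  elim: k => [|k [c -> c0]].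
    by rewrite addn1; exists (f (u m)).2; have [] := fP _ (u_bad m).
  have [fE _ _] := fP _ (u_bad (m + k.+1)%N).
  exists ((f (u (m + k.+1)%N)).2 + c); last by case/pointedP => _ /c0.
  by rewrite {1}fE addrA !addnS.
have [m [n [mn [c unE]]]] := semigroup_dickson u.
have [d] := u_desc m (n - m.+1)%N.
rewrite addnS -addSn subnKC // => umE d0.
move: umE; rewrite unE -addrA -[LHS]addr0 => /semigroup_addrI /esym /pointedP[_].
exact: d0.
Qed.

Lemma hilbert_basis_comb0 alpha :
  comb alpha = 0 -> {in hilbert_basis S, forall x, alpha x = 0%N}.
Proof.
move=> + x xH; rewrite /comb (big_fsetD1 x) //= => /pointedP[+ _].
have /hilbert_basisP[x_neq0 _] := xH.
by case: (alpha x) => // k; rewrite mulrS => /pointedP[/x_neq0].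
Qed.

(* An infinite set of lengths would, by Dickson's lemma, yield two
   representations of [a], one dominating the other; their difference is a
   nontrivial combination equal to 0. *)
Lemma finite_lengths a : finite_set (lengths a).
Proof.
have [[N NP]|no_bound] := pselect (exists N, forall k, lengths a k -> (k <= N)%N).
  by apply: (sub_finite_set _ (finite_II N.+1)) => k /NP.
have {no_bound}unbounded N : exists alpha, a = comb alpha /\ (N < weight alpha)%N.
  apply: contrapT => no; apply: no_bound; exists N => k [alpha aE kE].
  rewrite leqNgt; apply/negP => Nk; apply: no; exists alpha; split=> //.
  by rewrite -[weight _]kE.
have {unbounded}[f fP] := choice unbounded.
(* Each term outweighs its predecessor, as [f N] has weight above [N]. *)
pose alpha n := iter n (fun beta => f (weight beta)) (f 0).
have alphaE n : a = comb (alpha n) by case: n => [|n]; apply: (fP _).1.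
have alpha_lt : {homo weight \o alpha : m n / (m < n)%N}.
  by apply: homo_ltn ltn_trans _ => n; apply: (fP _).2.
have [m [n [mn le_mn]]] := dickson (hilbert_basis S) alpha.
have := comb_sub le_mn; rewrite -!/(comb _) -!alphaE -[LHS]addr0.
move=> /semigroup_addrI /esym /hilbert_basis_comb0 diff0.
have := alpha_lt _ _ mn; rewrite /= ltnNge => /negP[].
rewrite /weight [leqLHS]big_seq [leqRHS]big_seq; apply: leq_sum => x xH.
by rewrite -subn_eq0 diff0.
Qed.

Lemma max_length_ge a k : lengths a k -> (k <= max_length a)%N.
Proof.
move=> ak; rewrite /max_length; apply: (@leq_bigmax_seq _ _ xpredT id) => //.
by rewrite in_fset_set ?inE //; exact: finite_lengths.
Qed.

Lemma max_length_attained a : lengths a (max_length a).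
Proof.
have [alpha aE] := hilbert_basis_generates a.
have k0 : lengths a (weight alpha) by exists alpha.
have mem k : k \in fset_set (lengths a) -> lengths a k.
  by rewrite in_fset_set ?inE //; exact: finite_lengths.
(* The first alternative covers the default value 0 of an empty maximum; there the known length
   [weight alpha] must itself be 0. *)
have [max0|//] : max_length a = 0%N \/ lengths a (max_length a).
  rewrite {2}/max_length big_seq /max_length big_seq.
  elim/big_ind: _ => [|k l ak al|k /mem]; [by left| |by right].
  by rewrite /maxn; case: ifP.
by have := max_length_ge k0; rewrite max0 leqn0 => /eqP <-.
Qed.

Lemma max_length_superadditive a b :
  (max_length a + max_length b <= max_length (a + b)%R)%N.
Proof.
have [alpha aE ->] := max_length_attained a.
have [beta bE ->] := max_length_attained b.
apply: max_length_ge; exists (fun x => alpha x + beta x)%N.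
  by rewrite {1}aE {1}bE -combD.
by rewrite -big_split.
Qed.

Lemma max_length0 : max_length (0 : S) = 0%N.
Proof.
have [alpha /esym/hilbert_basis_comb0 alpha0 ->] := max_length_attained 0.
by rewrite big_seq big1.
Qed.

(** A nonzero element has positive length, which superadditivity accumulates; its multiples thus
    leave every [H_ i]. *)
Lemma max_length_mulrn a n : a <> 0 -> (n <= max_length (a *+ n)%R)%N.
Proof.
move=> a_neq0; elim: n => // n IH; rewrite mulrS.
apply: leq_trans (max_length_superadditive _ _); rewrite -add1n leq_add // lt0n.
apply/eqP => a_len0; apply: a_neq0.
have [alpha] := max_length_attained a; rewrite a_len0 => -> /esym/eqP.
rewrite sum_nat_seq_eq0 => /allP alpha0.
by rewrite big_seq big1 // => x /alpha0 /= /eqP ->; rewrite mulr0n.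
Qed.

(** In a longest factorization of an element of [H_ i] every multiplicity is at most [i]. *)
Lemma finite_H i : finite_set (H_ i : set S).
Proof.
have fin_comb s : finite_set [set a : S | exists2 alpha : S -> nat,
    {in s, forall x, (alpha x <= i)%N} & a = \sum_(x <- s) x *+ alpha x].
  elim: s => [|x s IH].
    apply: (sub_finite_set _ (finite_set1 0)) => _ [alpha _ ->] /=.
    by rewrite big_nil.
  have fin_mul := finite_image (fun k => x *+ k) (finite_II i.+1).
  apply: (sub_finite_set _ (finite_image2 +%R fin_mul IH)).
  move=> _ [alpha le_i ->]; rewrite big_cons.
  exists (x *+ alpha x).
    by exists (alpha x) => //=; rewrite ltnS le_i ?mem_head.
  exists (\sum_(y <- s) y *+ alpha y) => //; exists alpha => // y ys.
  by rewrite le_i // inE ys orbT.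
apply: (sub_finite_set _ (fin_comb (hilbert_basis S))) => a a_len.
have [alpha aE lenE] := max_length_attained a.
exists alpha => // x xH; apply: leq_trans a_len; rewrite lenE.
by rewrite (big_fsetD1 x) //= leq_addr.
Qed.

Lemma H_subset_seq i : exists s, forall a, H_ i a -> a \in s.
Proof. by have /finite_seqP[s HE] := finite_H i; exists s => a; rewrite HE. Qed.

End PointedAffineSemigroup.

(** * Products of monomials and the ideals [nbhs_ideal i] *)

Section SemigroupAlgebra.
Variables (R : realType) (S : pointedAffineSemigroup).
Implicit Types (a b : S) (f g : CSinf R S).

Definition chi_diff a : CSinf R S := chi_fin R a - chi_infty R S.

Lemma chiM a b : chi R a * chi R b = chi R (a + b).
Proof. by rewrite malgM_def fgmulUU mul1r. Qed.

Lemma chi_finM a b : chi_fin R a * chi_fin R b = chi_fin R (a + b).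
Proof. by rewrite malgM_def fgmulUU mul1r. Qed.

Lemma chi_fin_inftyM a : chi_fin R a * chi_infty R S = chi_infty R S.
Proof. by rewrite malgM_def fgmulUU mul1r. Qed.

Lemma chi_inftyM : chi_infty R S * chi_infty R S = chi_infty R S.
Proof. by rewrite malgM_def fgmulUU mul1r. Qed.

Lemma chiZ_inj a (c d : complex R) : c *: chi R a = d *: chi R a -> c = d.
Proof. by move/malgP/(_ a); rewrite !mcoeffZ mcoeffUU !mulr1. Qed.

Lemma monalgUZ (K : choiceType) (c : complex R) (k : K) :
  << c *g k >> = c *: (<< 1 *g k >> : {malg (complex R)[K]}).
Proof. by apply/malgP => l; rewrite mcoeffZ !mcoeffU mulrnAr mulr1. Qed.

Lemma CS_inclusionZ c b : CS_inclusion (c *: chi R b) = c *: chi_fin R b.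
Proof.
rewrite /CS_inclusion -monalgUZ msuppU; case: eqVneq => [->|c_neq0].
  by rewrite big_seq_fset0 scale0r.
by rewrite big_seq_fset1 mcoeffUU.
Qed.

Lemma one_sub_chi_inftyM b :
  (1 - chi_infty R S) * chi_fin R b = chi_diff b.
Proof. by rewrite mulrBl mul1r mulrC chi_fin_inftyM. Qed.

Lemma nbhs_ideal0 i : nbhs_ideal i (0 : CSinf R S).
Proof. by exists [::]; split=> //; rewrite big_nil. Qed.

Lemma nbhs_idealD i f g :
  nbhs_ideal i f -> nbhs_ideal i g -> nbhs_ideal i (f + g).
Proof.
move=> [s [sP ->]] [t [tP ->]]; exists (s ++ t); split; last by rewrite big_cat.
by move=> p; rewrite mem_cat => /orP[/sP|/tP].
Qed.

Lemma nbhs_ideal_chi_diff i c a : ~ H_ i a -> nbhs_ideal i (c *: chi_diff a).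
Proof.
move=> ai; exists [:: (c *: 1, chi_diff a)]; split.
  by move=> p; rewrite inE => /eqP ->; exists a.
by rewrite big_seq1 -scalerAl mul1r.
Qed.

(* The ideal is spanned, as a vector space, by its generators:
   [chi^b (chi^a - chi^oo) = chi^(a+b) - chi^oo], [chi^oo (chi^a - chi^oo) = 0]
   and the complement of [H_i] absorbs S. *)
Lemma nbhs_ideal_ind i (P : CSinf R S -> Prop) :
  P 0 -> (forall f g, P f -> P g -> P (f + g)) ->
  (forall c a, ~ H_ i a -> P (c *: chi_diff a)) ->
  forall f, nbhs_ideal i f -> P f.
Proof.
move=> P0 PD Pgen _ [s [sP ->]]; rewrite big_seq; elim/big_ind: _ => // p.
move=> /sP[a ai ->]; rewrite -/(chi_diff a) [p.1]monalgE mulr_suml.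
elim/big_ind: _ => // -[b|] _; rewrite monalgUZ -scalerAl.
  rewrite mulrBr -/(chi_fin R b) chi_finM chi_fin_inftyM; apply: Pgen.
  move=> ba_len; apply: ai; apply: leq_trans ba_len.
  by apply: leq_trans (max_length_superadditive _ _); rewrite leq_addl.
rewrite mulrBr -/(chi_infty R S) [X in X - _]mulrC chi_fin_inftyM chi_inftyM.
by rewrite subrr scaler0.
Qed.

(** With [i = 0] and [a = 0], this excludes nonzero multiples of [1 - chi^oo] from the ideal. *)
Lemma nbhs_ideal_coef i f a : H_ i a -> nbhs_ideal i f -> f@_(Some a) = 0.
Proof.
move=> ai; apply: (nbhs_ideal_ind (P := fun f => f@_(Some a) = 0)).
- by rewrite mcoeff0.
- by move=> g h g0 h0; rewrite mcoeffD g0 h0 addr0.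
move=> c b bi; rewrite mcoeffZ mcoeffB !mcoeffU /= subr0.
case: eqP => [[ba]|]; last by rewrite mulr0.
by case: bi; rewrite ba.
Qed.

End SemigroupAlgebra.

(** * Shifts of semigroup elements by a Demazure root *)

Section DemazureRoot.
Variables (R : realType) (S : pointedAffineSemigroup) (M : zmodType).
Variables (iota : {additive S -> M}) (rho : {additive M -> int}) (e : M).
Hypothesis iota_lattice : generated_lattice iota.
Hypothesis root_e : demazure_root R iota rho e.
Implicit Types (a b : S).

(** [rho] lies on its own half-line, hence in the dual cone. *)
Lemma rho_ge0 a : 0 <= rho (iota a).
Proof.
have [[[_ [half_sub _]] _ _] _] := root_e.
have rho_half : halfline rho ((intmul (1 : R) \o rho) : {additive M -> R}).
  by exists 1 => // m; rewrite mul1r.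
by have := half_sub _ rho_half a; rewrite /= ler0z.
Qed.

Lemma rho_e : rho e = -1.
Proof. by have [[]] := root_e. Qed.

Definition height a : nat := `|rho (iota a)|%N.

Lemma heightE a : rho (iota a) = (height a)%:Z.
Proof. by rewrite gez0_abs // rho_ge0. Qed.

Lemma height0 : height 0 = 0%N.
Proof. by rewrite /height !raddf0. Qed.

Lemma height_shift n a b : iota b = iota a + e *+ n -> height a = (height b + n)%N.
Proof.
move=> ab; apply/eqP; rewrite -eqz_nat PoszD -!heightE ab raddfD raddfMn /= rho_e.
by rewrite mulNrn natz subrK.
Qed.

(** The Demazure derivation sends the monomial of [a] to one at [iota a + e] with nonzero
    coefficient; stability of C[S] puts that exponent in S. *)
Lemma root_shift a : (0 < height a)%N -> exists b, iota b = iota a + e.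
Proof.
move=> a_gt0; have [_ /(_ << 1 *g iota a >>)] := root_e.
have suppE : msupp (<< 1 *g iota a >> : CM R M) = [fset iota a]%fset.
  by rewrite msuppU oner_eq0.
move=> /(_ _ (iota a + e))[m||b bE]; last by exists b.
  by rewrite suppE inE => /eqP ->; exists a.
rewrite /demazure_derivation suppE big_seq_fset1 mcoeffUU mul1r msuppU.
by rewrite intr_eq0 heightE eqz_nat eqn0Ngt a_gt0 /= inE.
Qed.

Lemma root_no_shift a b : height a = 0%N -> iota b <> iota a + e.
Proof. by move=> a0 ab; have := @height_shift 1 a b ab; rewrite a0 addn1. Qed.

Lemma root_shiftn n a : (n <= height a)%N -> exists b, iota b = iota a + e *+ n.
Proof.
elim: n => [|n IH] a_ge; first by exists a; rewrite addr0.
have [b bE] := IH (ltnW a_ge).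
have [c cE] : exists c, iota c = iota b + e.
  by apply: root_shift; rewrite (height_shift bE) -add1n leq_add2r in a_ge.
by exists c; rewrite cE bE mulrSr addrA.
Qed.

(** * Homogeneous derivations are multiples of the Demazure derivation *)

Section HomogeneousDerivation.
Variable D' : {linear CS R S -> CS R S}.
Hypotheses (D'_der : derivation D') (D'_hom : homogeneous iota e D').

(* Writing [D' (chi^a) = c(a) chi^(a + e)], the Leibniz rule makes [c]
   additive; it vanishes where [rho] does, because [rho] is negative on the
   shift by [e], so [c(a) - c(a + e)] being constant forces [c = lambda rho]. *)
Lemma homogeneous_derivation_scalar :
  exists2 lambda : complex R, lambda != 0 &
    forall a b, iota b = iota a + e ->
      D' (chi R a) = (lambda *+ height a) *: chi R b.
Proof.
have [iota_inj _] := iota_lattice.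
have [[f0 D'f0] homP] := D'_hom.
have D'0 a : ~ (exists b, iota b = iota a + e) -> D' (chi R a) = 0.
  by have [] := homP a.
(* Where the shift leaves S, [D'] determines no coefficient; the value 0 makes [c] additive. *)
have coefP a : exists c, [/\ forall b, iota b = iota a + e ->
      D' (chi R a) = c *: chi R b &
    ~ (exists b, iota b = iota a + e) -> c = 0].
  have [[b bE]|no_b] := pselect (exists b, iota b = iota a + e).
    have [/(_ b bE)[c cE] _] := homP a; exists c; split=> [b' b'E|[]]; last by exists b.
    rewrite cE; congr (_ *: chi R _). by apply: iota_inj; rewrite bE b'E.
  by exists 0; split=> // b bE; case: no_b; exists b.
have {coefP}[c cP] := choice coefP.
have cE a b : iota b = iota a + e -> D' (chi R a) = c a *: chi R b.
  by have [+ _] := cP a => /(_ b).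
have c0 a : ~ (exists b, iota b = iota a + e) -> c a = 0.
  by have [] := cP a.
(* [a + b] may be shiftable by [e] while [a] is not; both sides are then 0. *)
have D'M a b x : iota x = iota (a + b) + e ->
    D' (chi R a) * chi R b = c a *: chi R x.
  move=> xE; have [[y yE]|no_y] := pselect (exists y, iota y = iota a + e).
    rewrite (cE _ _ yE) -scalerAl chiM; congr (_ *: chi R _); apply: iota_inj.
    by rewrite xE !raddfD /= yE addrAC.
  by rewrite D'0 // c0 // mul0r scale0r.
have cD a b : c (a + b) = c a + c b.
  have [[x xE]|no_x] := pselect (exists x, iota x = iota (a + b) + e).
    apply: (@chiZ_inj _ _ x); rewrite -cE // -chiM D'_der (D'M _ _ x) //.
    by rewrite [chi R a * _]mulrC (D'M _ _ x) ?scalerDl // [b + a]addrC.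
  rewrite !c0 ?addr0 // => -[y yE]; apply: no_x.
    by exists (a + y); rewrite !raddfD /= yE addrA.
  by exists (y + b); rewrite !raddfD /= yE addrAC.
have c_height0 a : height a = 0%N -> c a = 0.
  by move=> a0; apply: c0 => -[b]; apply: root_no_shift.
have c_shift a b a' b' : iota b = iota a + e -> iota b' = iota a' + e ->
    c a = c b + (c a' - c b').
  move=> bE b'E; have ab : a + b' = b + a'.
    by apply: iota_inj; rewrite !raddfD /= bE b'E addrA addrAC.
  by rewrite addrA -cD -ab cD addrK.
have [a1 D'a1] : exists a, D' (chi R a) != 0.
  apply: contrapT => no_a; case/negP: D'f0; apply/eqP.
  rewrite [f0]monalgE linear_sum big1 // => a _; rewrite monalgUZ linearZ /=.
  have [->|Da] := eqVneq (D' << 1 *g a >>) 0; first by rewrite scaler0.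
  by case: no_a; exists a.
have [b1 b1E] : exists b, iota b = iota a1 + e.
  by apply: contrapT => /D'0 /eqP; rewrite (negPf D'a1).
(* The drop of [c] along one shift. A shift also lowers the height by one, so [c] follows by
   induction on the height. *)
pose lambda := c a1 - c b1.
have c_lambda a : c a = lambda *+ height a.
  move: {2}(height a) (erefl (height a)) => k; elim: k a => [|k IH] a ak.
    by rewrite ak mulr0n c_height0.
  have [b bE] : exists b, iota b = iota a + e by apply: root_shift; rewrite ak.
  have bk : height b = k by apply/eqP; rewrite -eqSS -ak (@height_shift 1 a b bE) addn1.
  by rewrite (c_shift _ _ _ _ bE b1E) IH // bk ak mulrSr.
exists lambda => [|a b bE]; last by rewrite -c_lambda; apply: cE.
by apply: contra_neq D'a1 => l0; rewrite (cE _ _ b1E) c_lambda l0 mul0rn scale0r.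
Qed.

Lemma homogeneous_derivation_height0 a : height a = 0%N -> D' (chi R a) = 0.
Proof.
have [_ /(_ a)[_ D'0]] := D'_hom => a0; apply: D'0 => -[b].
exact: root_no_shift.
Qed.

End HomogeneousDerivation.

(** * Iterates, continuity and topological integrability *)

Section QuasiHomogeneousDerivation.
Variables (D : {linear CSinf R S -> CSinf R S}) (lambda : complex R).
Hypothesis lambda_neq0 : lambda != 0.
Hypothesis D_chi_infty : D (chi_infty R S) = 0.
Hypothesis D_chi_shift : forall a b, iota b = iota a + e ->
  D (chi_fin R a) = (lambda *+ height a) *: chi_diff R b.
Hypothesis D_chi_height0 : forall a, height a = 0%N -> D (chi_fin R a) = 0.

Lemma D_chi_diff a : D (chi_diff R a) = D (chi_fin R a).
Proof. by rewrite linearB /= D_chi_infty subr0. Qed.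

(** Each step contributes a factor [lambda *+ height x], nonzero because [x] still admits a
    shift. *)
Lemma iter_D_chi_diff n a b : iota b = iota a + e *+ n ->
  exists2 c, c != 0 & iter n D (chi_diff R a) = c *: chi_diff R b.
Proof.
have [iota_inj _] := iota_lattice.
elim: n b => [|n IH] b bE.
  exists 1; first exact: oner_neq0.
  by rewrite scale1r; congr chi_diff; apply: iota_inj; rewrite bE addr0.
have aE := height_shift bE.
have [x xE] : exists x, iota x = iota a + e *+ n.
  by apply: root_shiftn; rewrite aE addnS leqW // leq_addl.
have [c c_neq0 cE] := IH _ xE.
have bxE : iota b = iota x + e by rewrite bE xE mulrSr addrA.
exists (c * (lambda *+ height x)).
  rewrite mulf_neq0 // mulrn_eq0 negb_or lambda_neq0 andbT.
  by rewrite (@height_shift 1 x b bxE) addn1.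
by rewrite iterS cE linearZ /= D_chi_diff (D_chi_shift bxE) scalerA.
Qed.

Lemma iter_D0 n : iter n D 0 = 0.
Proof. by elim: n => //= n ->; rewrite linear0. Qed.

Lemma iter_DD n f g : iter n D (f + g) = iter n D f + iter n D g.
Proof. by elim: n => //= n ->; rewrite linearD. Qed.

Lemma iter_DZ n c f : iter n D (c *: f) = c *: iter n D f.
Proof. by elim: n => //= n ->; rewrite linearZ. Qed.

(** The first [height a] steps lead to height 0, where [D] vanishes. *)
Lemma iter_D_chi_diff0 n a :
  (height a < n)%N -> iter n D (chi_diff R a) = 0.
Proof.
move=> a_lt; have [b bE] := root_shiftn (leqnn (height a)).
have [c _ cE] := iter_D_chi_diff bE.
have b0 : height b = 0%N.
  by have /eqP := height_shift bE; rewrite -{1}[height a]add0n eqn_add2r => /eqP.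
rewrite -(subnK a_lt) addnS -addSn iterD cE iter_DZ iterSr.
by rewrite D_chi_diff D_chi_height0 // iter_D0 scaler0.
Qed.

(* Dickson's lemma replaces the cone argument: if [h - n e] lies in S for all
   [n], then so does some [- k e] with [k > 0], which is then shifted by [e]. *)
Lemma opp_root_mem h :
  (forall n, exists a, iota h = iota a + e *+ n) -> exists a, iota a = - e.
Proof.
move=> /choice[u uE].
have [m [n [mn [k uk]]]] := semigroup_dickson u.
have kE : 0 = iota k + e *+ (n - m).
  move: (uE n); rewrite (uE m) uk raddfD /= -{1}(subnK (ltnW mn)) mulrnDr addrA.
  by move/addIr; rewrite -addrA -[LHS]addr0 => /addrI.
have k_height : height k = (n - m)%N.
  by rewrite (@height_shift (n - m) k 0) ?height0 // raddf0.
have [|a aE] := @root_shiftn (n - m).-1 k; first by rewrite k_height leq_pred.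
exists a; apply/eqP; rewrite -addr_eq0 aE -addrA -mulrSr prednK ?subn_gt0 //.
by rewrite -kE.
Qed.

Lemma height_opp_root v : iota v = - e -> height v = 1%N.
Proof. by move=> ve; rewrite /height ve raddfN /= rho_e opprK. Qed.

(** Each element of the finite set [H_ i] is unreachable by some number of shifts, hence by any
    larger number, since the surplus shifts can be performed first without leaving S. *)
Lemma exit_H i : ~ (exists a, iota a = - e) ->
  exists n0, forall n a b, (n0 <= n)%N -> iota b = iota a + e *+ n -> ~ H_ i b.
Proof.
move=> no_opp; have [s sP] := @H_subset_seq S i.
suff [n0 n0P] : exists n0, forall n a b,
    (n0 <= n)%N -> b \in s -> iota b <> iota a + e *+ n.
  by exists n0 => n a b n_ge bE /sP bs; exact: n0P n_ge bs bE.
elim: s {sP} => [|h s [n1 n1P]]; first by exists 0%N.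
have [n2 n2P] : exists n2, forall a, iota h <> iota a + e *+ n2.
  apply: contrapT => no_n2; apply: no_opp; apply: (@opp_root_mem h) => n.
  by apply: contrapT => no_a; apply: no_n2; exists n => a aE; apply: no_a; exists a.
exists (maxn n1 n2) => n a b; rewrite geq_max => /andP[n1n n2n].
rewrite inE => /predU1P[->|bs]; last exact: n1P.
move=> hE; have [c cE] : exists c, iota c = iota a + e *+ (n - n2).
  by apply: root_shiftn; rewrite (height_shift hE) (leq_trans (leq_subr _ _)) ?leq_addl.
by apply: (n2P c); rewrite cE -addrA -mulrnDr subnK.
Qed.

(** An element of the finite set [H_ i] has at most one preimage under the shift; [j] bounds the
    lengths of these preimages. *)
Lemma shift_continuous i :
  exists j, forall a b, ~ H_ j a -> iota b = iota a + e -> ~ H_ i b.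
Proof.
have [iota_inj _] := iota_lattice.
have [s sP] := @H_subset_seq S i.
suff [j jP] : exists j, forall a b, b \in s -> iota b = iota a + e -> H_ j a.
  by exists j => a b aj bE /sP bs; apply: aj; apply: jP bs bE.
elim: s {sP} => [|h s [j jP]]; first by exists 0%N.
have [[x xE]|no_x] := pselect (exists x, iota h = iota x + e); last first.
  exists j => a b; rewrite inE => /predU1P[->|]; last exact: jP.
  by move=> aE; case: no_x; exists a.
exists (maxn j (max_length x)) => a b; rewrite inE /H_ /= leq_max.
move=> /predU1P[->|bs bE]; last by rewrite (jP a b).
rewrite xE => /addIr /iota_inj ->; by rewrite leqnn orbT.
Qed.

Lemma quasi_homogeneous_continuous : continuous_map D.
Proof.
move=> f i; have [j jP] := shift_continuous i; exists j => g gj.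
rewrite linearD addrAC subrr add0r.
apply: (nbhs_ideal_ind (P := fun g => nbhs_ideal i (D g))) gj.
- by rewrite linear0; exact: nbhs_ideal0.
- by move=> g1 g2 ig1 ig2; rewrite linearD; exact: nbhs_idealD.
move=> c a aj; rewrite linearZ /= D_chi_diff.
have [a0|a_gt0] := posnP (height a).
  by rewrite D_chi_height0 // scaler0; exact: nbhs_ideal0.
have [b bE] := root_shift a_gt0.
by rewrite (D_chi_shift bE) scalerA; apply: nbhs_ideal_chi_diff; apply: jP bE.
Qed.

Lemma topologically_integrableP : locally_nilpotent D ->
  topologically_integrable D <-> ~ (exists a, iota a = - e).
Proof.
have [iota_inj _] := iota_lattice.
move=> D_nil; split=> [[_ D_int] [v vE]|no_opp].
  have [n0 [j /(_ (maxn n0 j.+1))]] := D_int 0 0%N.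
  (* [n >= n0] makes integrability apply, and [n > j] puts [v *+ n] outside [H_ j]; [n] shifts by
     [e] take it to 0. *)
  set n := maxn n0 j.+1; rewrite leq_maxl => /(_ isT (chi_diff R (v *+ n))).
  have v_neq0 : v <> 0.
    by move=> v0; have := height_opp_root vE; rewrite v0 height0.
  have [|c c_neq0 cE] := @iter_D_chi_diff n (v *+ n) 0.
    by rewrite raddf0 raddfMn /= vE mulNrn addNr.
  rewrite add0r cE => D_in; case/negP: c_neq0; apply/eqP.
  have H0 : H_ 0 (0 : S) by rewrite /H_ /= max_length0.
  have := nbhs_ideal_coef H0 (D_in _).
  rewrite mcoeffZ mcoeffB !mcoeffU /= subr0 eqxx mulr1; apply.
  rewrite -[chi_diff _ _]scale1r; apply: nbhs_ideal_chi_diff => /= len.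
  have := leq_trans (max_length_mulrn n v_neq0) len.
  by rewrite leqNgt /n leq_max leqnn orbT.
split=> [|f i]; first exact: quasi_homogeneous_continuous.
have [n1 D_f] := D_nil f; have [n2 n2P] := exit_H i no_opp.
(* [n1] steps annihilate [f], and [n2] is uniform in the starting exponent, so [j = 0] works. *)
exists (maxn n1 n2), 0%N => n; rewrite geq_max => /andP[n1n n2n] g g0.
rewrite iter_DD -{1}(subnK n1n) iterD D_f iter_D0 add0r.
apply: (nbhs_ideal_ind (P := fun g => nbhs_ideal i (iter n D g))) g0.
- by rewrite iter_D0; exact: nbhs_ideal0.
- by move=> g1 g2 ig1 ig2; rewrite iter_DD; exact: nbhs_idealD.
move=> c a _; rewrite iter_DZ; have [an|na] := ltnP (height a) n.
  by rewrite iter_D_chi_diff0 // scaler0; exact: nbhs_ideal0.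
have [b bE] := root_shiftn na; have [d _ ->] := iter_D_chi_diff bE.
by rewrite scalerA; apply: nbhs_ideal_chi_diff; apply: n2P n2n bE.
Qed.

End QuasiHomogeneousDerivation.

End DemazureRoot.

Theorem proposition4p6 (R : realType) (S : pointedAffineSemigroup)
    (M : zmodType) (iota : {additive S -> M}) (hM : generated_lattice iota)
    (rho : {additive M -> int}) (e : M) (he : demazure_root R iota rho e)
    (D : {linear CSinf R S -> CSinf R S})
    (hD : derivation D) (hD0 : exists f, D f != 0)
    (hqh : quasi_homogeneous iota e D) (hln : locally_nilpotent D) :
  topologically_integrable D <-> ~ (exists a : S, iota a = - e).
Proof.
have [D' [D'_der [D_infty D_chi] D'_hom]] := hqh.
have [lambda lambda_neq0 D'_chi] := homogeneous_derivation_scalar hM he D'_der D'_hom.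
apply: (topologically_integrableP hM he lambda_neq0) => // a.
  by move=> b bE; rewrite D_chi (D'_chi _ _ bE) CS_inclusionZ -scalerAr one_sub_chi_inftyM.
move=> a0; rewrite D_chi (homogeneous_derivation_height0 he D'_hom a0).
(* Writing 0 as a multiple of a monomial lets [CS_inclusionZ] evaluate the inclusion. *)
by rewrite -(scale0r (chi R 0)) CS_inclusionZ scale0r mulr0.
Qed.
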